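(* For $w\in W$ and a subset $\sigma\subseteq R^+$ put $$w\circ\sigma=\big(w*(\sigma\cup -\sigma^c)\big)\cap R^+,$$ where $\sigma^c=R^+\setminus\sigma$. Then $\circ: W\times\Gamma(R^+)\to\Gamma(R^+)$, $(w,\sigma)\mapsto w\circ\sigma$, is a (well-defined left) action of the group $W$ on the set $\Gamma(R^+)$ of all subsets of $R^+$.
   Context: $R^+$ is the positive root system (for a fixed choice of positive roots) of a semisimple Lie algebra over $\mathbb C$, $V$ is the real vector space spanned by $R^+$, and $W$ is the Weyl group acting linearly on $V$; the action of $w\in W$ on $v\in V$ is written $w*v$. For $S\subseteq V$, $w*S=\{w*v\mid v\in S\}$ and $-S=\{-v\mid v\in S\}$. $\Gamma(R^+)$ denotes here the set of all subsets of $R^+$ (including $\emptyset$). *)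

(* Defs.v *)
From HB Require Import structures.
From mathcomp Require Import all_boot all_order all_algebra.
From mathcomp Require Import finmap ring boolp reals.

Set Implicit Arguments.
Unset Strict Implicit.
Unset Printing Implicit Defensive.

Import Order.TTheory GRing.Theory Num.Theory.
Local Open Scope fset_scope.
Local Open Scope ring_scope.

Section RootSystem.
Variables (R : realType) (V : vectType R).
(* [{dot V for idfun}] is the type of positive definite symmetric bilinear
   forms on V (no conjugation), i.e. real inner products. *)
Implicit Types (form : {dot V for idfun}) (Phi Rp sigma : {fset V}).

Definition cartan_number form (a x : V) : R := 2 * form x a / form a a.

Definition reflection_fun form (a x : V) : V := x - cartan_number form a x *: a.

Lemma reflection_fun_is_linear form a : linear (reflection_fun form a).
Proof.
move=> k x y; rewrite /reflection_fun /cartan_number linearPl /=.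
rewrite scalerBr scalerA addrACA -opprD -scalerDl.
by congr (_ - _ *: _); ring.
Qed.

HB.instance Definition _ form a :=
  GRing.isLinear.Build R V V *:%R (reflection_fun form a)
    (reflection_fun_is_linear form a).

Definition reflection form (a : V) : 'End(V) := linfun (reflection_fun form a).

Lemma reflectionE form a x :
  reflection form a x = x - (2 * form x a / form a a) *: a.
Proof. by rewrite lfunE. Qed.

(* Reduced crystallographic root systems: by the classification, exactly the
   root systems of the semisimple complex Lie algebras, V being the real span
   of the roots with the inner product induced by the Killing form. *)
Record is_root_system form Phi : Prop := IsRootSystem {
  root_span : <<Phi>>%VS = fullv;
  root_neq0 : 0 \notin Phi;
  root_reflection :
    forall a b, a \in Phi -> b \in Phi -> reflection form a b \in Phi;
  root_integral :
    forall a b, a \in Phi -> b \in Phi -> cartan_number form a b \is a Num.int;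
  root_reduced :
    forall (a : V) (c : R), a \in Phi -> c *: a \in Phi -> c = 1 \/ c = -1
}.

Record is_positive_system Phi Rp : Prop := IsPositiveSystem {
  pos_sub : Rp `<=` Phi;
  pos_choice : forall a, a \in Phi -> (a \in Rp) (+) (- a \in Rp);
  pos_add :
    forall a b, a \in Rp -> b \in Rp -> a + b \in Phi -> a + b \in Rp
}.

(* The subgroup of GL(V) generated by the reflections in the roots; on
   invertible endomorphisms, [f^-1]%VF is the inverse. *)
Inductive in_weyl form Phi : 'End(V) -> Prop :=
| in_weyl_refl a : a \in Phi -> in_weyl form Phi (reflection form a)
| in_weyl_id : in_weyl form Phi \1%VF
| in_weyl_comp f g :
    in_weyl form Phi f -> in_weyl form Phi g -> in_weyl form Phi (f \o g)%VF
| in_weyl_inv f : in_weyl form Phi f -> in_weyl form Phi (f^-1)%VF.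

Record weyl_group form Phi := WeylElt {
  weyl_val :> 'End(V);
  weyl_valP : `[< in_weyl form Phi weyl_val >]
}.

HB.instance Definition _ form Phi := [isSub for @weyl_val form Phi].
HB.instance Definition _ form Phi := [Choice of weyl_group form Phi by <:].

Lemma reflectionK form a : involutive (reflection form a).
Proof.
move=> x; rewrite !reflectionE; have [->|a0] := eqVneq (form a a) 0.
  by rewrite invr0 !mulr0 !scale0r !subr0.
rewrite linearBl linearZl_LR /= -addrA -opprD -scalerDl.
have -> : 2 * form x a / form a a
    + 2 * (form x a - 2 * form x a / form a a * form a a) / form a a = 0.
  by field.
by rewrite scale0r subr0.
Qed.

Lemma in_weyl_lker0 form Phi f : in_weyl form Phi f -> lker f == 0%VS.
Proof.
elim=> {f} [a _||f g _ f0 _ g0|f _ f0].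
- by apply/lker0P; apply: (inv_inj (reflectionK form a)).
- by apply/lker0P => x y; rewrite !id_lfunE.
- by apply/lker0P => x y; rewrite !comp_lfunE => /(lker0P f0)/(lker0P g0).
- apply/lker0P => x y; rewrite -{2}[x](lker0_lfunVK f0).
  by move/(congr1 f); rewrite !lker0_lfunVK.
Qed.

Section WeylGroup.
Variables (form : {dot V for idfun}) (Phi : {fset V}).
Local Notation W := (weyl_group form Phi).

Lemma weyl_in (w : W) : in_weyl form Phi w.
Proof. exact/asboolP/weyl_valP. Qed.

Definition weyl_one : W := WeylElt (asboolT (in_weyl_id form Phi)).
Definition weyl_mul (v w : W) : W :=
  WeylElt (asboolT (in_weyl_comp (weyl_in v) (weyl_in w))).
Definition weyl_inv (w : W) : W := WeylElt (asboolT (in_weyl_inv (weyl_in w))).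

Lemma weyl_mulA : associative weyl_mul.
Proof. by move=> u v w; apply/val_inj; rewrite /= comp_lfunA. Qed.

Lemma weyl_mul1w : left_id weyl_one weyl_mul.
Proof. by move=> w; apply/val_inj; rewrite /= comp_lfun1l. Qed.

Lemma weyl_mulw1 : right_id weyl_one weyl_mul.
Proof. by move=> w; apply/val_inj; rewrite /= comp_lfun1r. Qed.

Lemma weyl_mulVw : left_inverse weyl_one weyl_inv weyl_mul.
Proof.
by move=> w; apply/val_inj; rewrite /= lker0_compVf ?(in_weyl_lker0 (weyl_in w)).
Qed.

Lemma weyl_mulwV : right_inverse weyl_one weyl_inv weyl_mul.
Proof.
by move=> w; apply/val_inj; rewrite /= lker0_compfV ?(in_weyl_lker0 (weyl_in w)).
Qed.

HB.instance Definition _ := isGroup.Build W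
  weyl_mulA weyl_mul1w weyl_mulw1 weyl_mulVw weyl_mulwV.
End WeylGroup.

Definition weyl_act form Phi (w : weyl_group form Phi) (S : {fset V}) :
  {fset V} := [fset w x | x in S].

Definition fset_opp (S : {fset V}) : {fset V} := [fset - x | x in S].

Definition circ form Phi Rp (w : weyl_group form Phi) sigma : {fset V} :=
  weyl_act w (sigma `|` fset_opp (Rp `\` sigma)) `&` Rp.

End RootSystem.

Definition is_left_action (G : groupType) (X : Type) (D : {pred X})
    (act : G -> X -> X) : Prop :=
  [/\ forall g x, x \in D -> act g x \in D,
      forall x, x \in D -> act 1%g x = x
    & forall g h x, x \in D -> act (g * h)%g x = act g (act h x)].

(* Main.v *)
(** A subset [sigma] of [R^+] is the same thing as a choice of one root from
    each pair of opposite roots, namely [T = sigma U -sigma^c]; the inverse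
    bijection is intersection with [R^+].  The Weyl group permutes the roots
    and commutes with negation, so it acts on such choices elementwise, and
    the operation of the theorem is this action carried over to the subsets of
    [R^+]. *)
Require Import Defs.
From mathcomp Require Import all_boot all_order all_algebra.
From mathcomp Require Import finmap reals.

Local Open Scope fset_scope.
Local Open Scope ring_scope.

Import Order.TTheory GRing.Theory.

Section SignChoices.
Context {R : realType} {V : vectType R}.
Implicit Types (form : {dot V for idfun}) (Phi Rp sigma T : {fset V}).

Lemma mem_fset_opp T x : (x \in fset_opp T) = (- x \in T).
Proof.
apply/imfsetP/idP => [[y yT ->]|xT]; first by rewrite opprK.
by exists (- x); rewrite ?opprK.
Qed.

(** Unlike the subsets of [Rp], the sets of this kind are permuted by the Weyl group. *)
Definition sign_choice Phi T : Prop :=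
  T `<=` Phi /\ forall a, a \in Phi -> (a \in T) (+) (- a \in T).

Definition signed_set Rp sigma : {fset V} :=
  sigma `|` fset_opp (Rp `\` sigma).

Lemma in_signed_set Rp sigma x :
  (x \in signed_set Rp sigma) =
  (x \in sigma) || (- x \notin sigma) && (- x \in Rp).
Proof. by rewrite in_fsetU mem_fset_opp in_fsetD. Qed.

(** The reflection in a root negates that root; positive definiteness makes the denominator
    [form a a] nonzero. *)
Lemma root_opp form Phi : is_root_system form Phi ->
  forall a, a \in Phi -> - a \in Phi.
Proof.
move=> rootPhi a aPhi; have a0 : a != 0.
  by apply: contraNneq (root_neq0 rootPhi) => <-.
have -> : - a = reflection form a a; last exact: root_reflection rootPhi _ _ _ _.
rewrite reflectionE mulfK ?gt_eqF ?neq0_dnorm_gt0 //.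
by rewrite scaler_nat mulr2n opprD addNKr.
Qed.

Lemma positive_sign_choice Phi Rp :
  is_positive_system Phi Rp -> sign_choice Phi Rp.
Proof. by move=> posRp; split; [exact: pos_sub posRp|exact: pos_choice posRp]. Qed.

Lemma signed_set_sign_choice form Phi Rp sigma : is_root_system form Phi ->
  sign_choice Phi Rp -> sigma `<=` Rp ->
  sign_choice Phi (signed_set Rp sigma).
Proof.
move=> rootPhi [subRp choRp] /fsubsetP subs; split.
  apply/fsubsetP => x; rewrite in_signed_set => /orP[/subs|/andP[_]].
    exact: (fsubsetP subRp).
  by move=> /(fsubsetP subRp)/(root_opp _ _ rootPhi); rewrite opprK.
move=> a /choRp; rewrite !in_signed_set opprK.
(* As boolean implications, the inclusion of [sigma] in [Rp] at [a] and [- a] excludes the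
   impossible membership patterns. *)
move: (subs a) (subs (- a)).
case: (a \in sigma) (a \in Rp) (- a \in sigma) (- a \in Rp) => [] [] [] [] //=;
  by do 2![move=> ? // | move=> /(_ isT)].
Qed.

(** The opposite of a positive root is not positive, so the negated part of [signed_set] does not
    meet [Rp]. *)
Lemma signed_setK Rp Phi sigma : sign_choice Phi Rp -> sigma `<=` Rp ->
  signed_set Rp sigma `&` Rp = sigma.
Proof.
move=> [subRp choRp] /fsubsetP subs; apply/fsetP => x.
rewrite in_fsetI in_signed_set.
have [xRp|xRp] := boolP (x \in Rp); last first.
  by rewrite andbF; apply/esym/negbTE/(contra (subs x)).
have /choRp := fsubsetP subRp x xRp; rewrite xRp /= => /negbTE->.
by rewrite andbF orbF andbT.
Qed.

(** A sign choice is determined by its positive members: it contains a negative root exactly when it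
    omits the opposite positive one. *)
Lemma fsetI_signK form Phi Rp T : is_root_system form Phi ->
  sign_choice Phi Rp -> sign_choice Phi T -> signed_set Rp (T `&` Rp) = T.
Proof.
move=> rootPhi [subRp choRp] [subT choT]; apply/fsetP => x.
rewrite in_signed_set !in_fsetI.
have [xPhi|xPhi] := boolP (x \in Phi).
  move: (choRp x xPhi) (choT x xPhi).
  by case: (x \in T) (x \in Rp) (- x \in T) (- x \in Rp) => [] [] [] [].
have -> : (x \in T) = false by apply/negbTE/(contra (fsubsetP subT x)).
have -> : (- x \in Rp) = false; last by rewrite andbF.
apply/negbTE; apply: contra xPhi.
by move=> /(fsubsetP subRp)/(root_opp _ _ rootPhi); rewrite opprK.
Qed.

(** Stating an equality rather than an inclusion lets the induction pass to inverses: apply the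
    inverse of [f] to both sides. *)
Lemma in_weyl_root form Phi f : is_root_system form Phi ->
  in_weyl form Phi f -> [fset f x | x in Phi] = Phi.
Proof.
move=> rootPhi; elim=> {f} [a aPhi||f g _ fPhi _ gPhi|f fW fPhi].
- apply/fsetP => x; apply/imfsetP/idP => [[y yPhi ->]|xPhi].
    exact: root_reflection rootPhi _ _ _ _.
  by exists (reflection form a x);
    rewrite ?reflectionK //; apply: root_reflection rootPhi _ _ _ _.
- apply/fsetP => x; apply/imfsetP/idP => [[y yPhi ->]|xPhi].
    by rewrite id_lfunE.
  by exists x; rewrite ?id_lfunE.
- rewrite -[RHS]fPhi -[in RHS]gPhi -imfset_comp.
  by apply: eq_imfset => // x; rewrite comp_lfunE.
- rewrite -[in LHS]fPhi -imfset_comp -[RHS]imfset_id.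
  by apply: eq_imfset => // x; rewrite /= lker0_lfunK ?(in_weyl_lker0 fW).
Qed.

Lemma mem_weyl_act form Phi (w : weyl_group form Phi) T x :
  (w x \in weyl_act w T) = (x \in T).
Proof. by rewrite mem_imfset //; apply/lker0P/in_weyl_lker0/weyl_in. Qed.

Lemma weyl_act_sign_choice form Phi (w : weyl_group form Phi) T :
  is_root_system form Phi -> sign_choice Phi T ->
  sign_choice Phi (weyl_act w T).
Proof.
move=> rootPhi [subT choT]; have wPhi := in_weyl_root _ _ _ rootPhi (weyl_in w).
split=> [|a].
  rewrite -[X in _ `<=` X]wPhi.
  by apply/fsubsetP => _ /imfsetP[x /= /(fsubsetP subT) xPhi ->]; apply: in_imfset.
rewrite -[X in _ \in X]wPhi => /imfsetP[x /= xPhi ->].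
by rewrite -linearN !mem_weyl_act choT.
Qed.

Lemma weyl_act1 form Phi T : weyl_act (1%g : weyl_group form Phi) T = T.
Proof.
by rewrite -[RHS]imfset_id; apply: eq_imfset => // x; rewrite id_lfunE.
Qed.

Lemma weyl_actM form Phi (g h : weyl_group form Phi) T :
  weyl_act (g * h)%g T = weyl_act g (weyl_act h T).
Proof.
by rewrite /weyl_act -imfset_comp; apply: eq_imfset => // x; rewrite comp_lfunE.
Qed.

Lemma circE form Phi Rp (w : weyl_group form Phi) sigma :
  circ Rp w sigma = weyl_act w (signed_set Rp sigma) `&` Rp.
Proof. by []. Qed.

End SignChoices.

Theorem theorem2p3 (R : realType) (V : vectType R) (form : {dot V for idfun})
    (Phi Rp : {fset V}) (rootPhi : is_root_system form Phi)
    (posRp : is_positive_system Phi Rp) :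
  is_left_action [in fpowerset Rp] (@circ R V form Phi Rp).
Proof.
have choRp := positive_sign_choice _ _ posRp.
split=> [w s _|s|g h s]; rewrite ?inE ?fpowersetE ?circE.
- exact: fsubsetIr.
- by move=> sRp; rewrite weyl_act1 (signed_setK _ _ _ choRp).
(* On the right, [h] yields a sign choice, which is cut down to [Rp] and then signed again before
   [g] acts; these two operations cancel. *)
- move=> sRp; rewrite weyl_actM (fsetI_signK _ _ _ _ rootPhi choRp) //.
  exact/weyl_act_sign_choice/(signed_set_sign_choice _ _ _ _ rootPhi choRp).
Qed.
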